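(* (i) Let $\rho_A$ be a state, let $\mathsf{X},\mathsf{Y}$ be binary measurements on $A$, and let $c^*=c^*(\rho_A,\mathsf{X},\mathsf{Y})$ be their effective overlap. Then for any bipartite state $\rho_{AD}$ with $\operatorname{tr}_D(\rho_{AD})=\rho_A$ and any two binary measurements $\mathsf{R},\mathsf{S}$ on $D$, $$\beta(\rho_{AD},\mathsf{X},\mathsf{Y},\mathsf{R},\mathsf{S})\le2\big(\sqrt{c^*}+\sqrt{1-c^*}\big).$$ (ii) Conversely, for any bipartite state $\rho_{AD}$ and any binary measurements $\mathsf{X},\mathsf{Y}$ on $A$ and $\mathsf{R},\mathsf{S}$ on $D$ with CHSH value $\beta=\beta(\rho_{AD},\mathsf{X},\mathsf{Y},\mathsf{R},\mathsf{S})$, $$c^*(\rho_A,\mathsf{X},\mathsf{Y})\le\frac12+\frac{\beta}{8}\sqrt{8-\beta^2},$$ where $\rho_A=\operatorname{tr}_D(\rho_{AD})$.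
   Context: All Hilbert spaces are finite-dimensional. A quantum state is a positive semidefinite operator of unit trace. A measurement (POVM) on $A$ is a finite family of positive semidefinite operators on $A$ summing to $\mathbb{1}_A$; it is projective if every element is a projector, and binary if it has two outcomes, labelled $0,1$. CHSH value: for a bipartite state $\rho_{AD}$ and binary measurements $\mathsf{X}=\{M_A^0,M_A^1\}$, $\mathsf{Y}=\{N_A^0,N_A^1\}$ on $A$ and $\mathsf{R}=\{R_D^0,R_D^1\}$, $\mathsf{S}=\{S_D^0,S_D^1\}$ on $D$, $$\beta(\rho_{AD},\mathsf{X},\mathsf{Y},\mathsf{R},\mathsf{S}):=2\operatorname{tr}\Big(\sum_{i=0}^1\big(M_A^i\otimes(R_D^i+S_D^i)+N_A^i\otimes(R_D^i+S_D^{1-i})\big)\rho_{AD}\Big)-4.$$ Effective overlap: for a state $\rho_A$ and measurements $\mathsf{X}=\{M_A^x\}$, $\mathsf{Y}=\{N_A^y\}$ on $A$, $$c^*(\rho_A,\mathsf{X},\mathsf{Y}):=\inf_{U,\mathsf{X}',\mathsf{Y}',\mathsf{K}'}\Big\{\sum_k \operatorname{tr}(P_{A'}^kU\rho_AU^\dagger)\,\max_x\Big\|\sum_y P_{A'}^kN_{A'}^yP_{A'}^k\cdot P_{A'}^kM_{A'}^xP_{A'}^k\cdot P_{A'}^kN_{A'}^yP_{A'}^k\Big\|\Big\},$$ where $\|\cdot\|$ is the operator norm and the infimum is over all embeddings (isometries) $U:A\to A'$ into an auxiliary space $A'$, all measurements $\mathsf{X}'=\{M_{A'}^x\}$, $\mathsf{Y}'=\{N_{A'}^y\}$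 on $A'$, and all projective measurements $\mathsf{K}'=\{P_{A'}^k\}$ on $A'$ such that $\sum_kU^\dagger P_{A'}^kM_{A'}^xP_{A'}^kU=M_A^x$ and $\sum_kU^\dagger P_{A'}^kN_{A'}^yP_{A'}^kU=N_A^y$ for all $x$ and $y$.
   Formalization: Part (ii) is proved under the added assumption β ≥ 2; without it the claim fails, e.g. for one-dimensional A and D with X = Y = (1,0) and R = S = (1/2,1/2), where β = 0 and c* = 1 but the right-hand side is 1/2. *)

(* Defs.v *)
(* MathComp / MathComp-Analysis. *)
From HB Require Import structures.
From mathcomp Require Import all_boot all_order all_algebra.
From mathcomp Require Import classical_sets reals complex.
From mathcomp Require mxtens.
Set Implicit Arguments.
Unset Strict Implicit.
Unset Printing Implicit Defensive.
Import Order.TTheory GRing.Theory Num.Theory.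
Local Open Scope ring_scope.
Local Open Scope sesquilinear_scope.
Local Open Scope classical_set_scope.

(* The space A of dimension a is C^a (column vectors), with operators
   'M[R[i]]_a; A (x) D is C^(a * d), the basis vector e_i (x) e_k having index
   mxtens_index (i, k). *)
Notation "A *t B" := (mxtens.tensmx A B)
  (at level 40, left associativity, format "A  *t  B") : ring_scope.

(* On R[i], [0 <= z] means that z is real and nonnegative, so hermitianity is
   implied. *)
Definition psdmx (R : realType) (n : nat) (A : 'M[R[i]]_n) : Prop :=
  forall v : 'cV[R[i]]_n, 0 <= (v ^t* *m A *m v) 0 0.

Definition is_state (R : realType) (n : nat) (rho : 'M[R[i]]_n) : Prop :=
  psdmx rho /\ \tr rho = 1.

Definition is_measurement (R : realType) (n : nat) (X : finType)
    (M : X -> 'M[R[i]]_n) : Prop :=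
  (forall x, psdmx (M x)) /\ \sum_x M x = 1%:M.

Definition is_projector (R : realType) (n : nat) (P : 'M[R[i]]_n) : Prop :=
  P ^t* = P /\ P *m P = P.

Definition is_projective_measurement (R : realType) (n : nat) (X : finType)
    (P : X -> 'M[R[i]]_n) : Prop :=
  is_measurement P /\ forall x, is_projector (P x).

Definition is_isometry (R : realType) (m n : nat) (U : 'M[R[i]]_(m, n)) :
    Prop :=
  U ^t* *m U = 1%:M.

(* The partial trace over the second factor D. *)
Definition ptrace2 (R : realType) (a d : nat) (rho : 'M[R[i]]_(a * d)) :
    'M[R[i]]_a :=
  \matrix_(i, j) \sum_(k < d)
    rho (mxtens.mxtens_index (i, k)) (mxtens.mxtens_index (j, k)).

Definition l2norm (R : realType) (n : nat) (v : 'cV[R[i]]_n) : R :=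
  Num.sqrt (complex.Re ((v ^t* *m v) 0 0)).

Definition opnorm (R : realType) (n : nat) (A : 'M[R[i]]_n) : R :=
  sup [set l2norm (A *m v) | v in [set v : 'cV[R[i]]_n | l2norm v <= 1]].

(* The outcomes 0 and 1 of a binary measurement are [false] and [true], so
   that 1 - i is [~~ i]. The traces below are real, being traces of products
   of two positive semidefinite operators; [complex.Re] only retypes them. *)
Definition chsh (R : realType) (a d : nat) (rho : 'M[R[i]]_(a * d))
    (M N : bool -> 'M[R[i]]_a) (Rm Sm : bool -> 'M[R[i]]_d) : R :=
  2 * complex.Re (\tr ((\sum_(i : bool)
         (M i *t (Rm i + Sm i) + N i *t (Rm i + Sm (~~ i)))) *m rho)) - 4.

Definition eff_overlap_feasible (R : realType) (a : nat) (X Y : finType)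
    (M : X -> 'M[R[i]]_a) (N : Y -> 'M[R[i]]_a) (a' r : nat)
    (U : 'M[R[i]]_(a', a)) (M' : X -> 'M[R[i]]_a') (N' : Y -> 'M[R[i]]_a')
    (P : 'I_r -> 'M[R[i]]_a') : Prop :=
  [/\ is_isometry U, is_measurement M', is_measurement N',
      is_projective_measurement P &
      (forall x, \sum_k U ^t* *m P k *m M' x *m P k *m U = M x) /\
      (forall y, \sum_k U ^t* *m P k *m N' y *m P k *m U = N y)].

(* The operator norms are nonnegative, so the unit 0 of the maximum is
   harmless. *)
Definition eff_overlap_value (R : realType) (a : nat) (X Y : finType)
    (rho : 'M[R[i]]_a) (a' r : nat)
    (U : 'M[R[i]]_(a', a)) (M' : X -> 'M[R[i]]_a') (N' : Y -> 'M[R[i]]_a')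
    (P : 'I_r -> 'M[R[i]]_a') : R :=
  \sum_k complex.Re (\tr (P k *m U *m rho *m U ^t*)) *
    \big[Num.max/0]_x opnorm (\sum_y
      (P k *m N' y *m P k) *m (P k *m M' x *m P k) *m (P k *m N' y *m P k)).

Definition eff_overlap (R : realType) (a : nat) (X Y : finType)
    (rho : 'M[R[i]]_a) (M : X -> 'M[R[i]]_a) (N : Y -> 'M[R[i]]_a) : R :=
  inf [set c : R | exists (a' r : nat) (U : 'M[R[i]]_(a', a))
         (M' : X -> 'M[R[i]]_a') (N' : Y -> 'M[R[i]]_a')
         (P : 'I_r -> 'M[R[i]]_a'),
       eff_overlap_feasible M N U M' N' P /\
       c = eff_overlap_value rho U M' N' P].

(* Main.v *)
(* Let A, B, X, Y be the differences of the two elements of M, N, Rm, Sm. The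
   CHSH value is the expectation of (A + B) (x) X + (A - B) (x) Y, and X, Y are
   contractions, so Cauchy-Schwarz leaves only the second moments of A + B and
   A - B. Write f c = 2 (sqrt c + sqrt (1 - c)), which increases on [0, 1/2] and
   decreases on [1/2, 1].

   If c* >= 1/2, an upper bound on c* is needed. Halmos dilations of A and B on
   the same space are reflections A', B', which commute with A'B' + B'A'. On its
   eigenspace for the eigenvalue l, (A' + B')^2 = 2 + l, (A' - B')^2 = 2 - l and
   the overlap is at most (1 + |l|/2)/2. Averaging over the eigenspaces, which
   are a feasible choice of K', gives beta <= f w and c* <= w for some w in
   [1/2, 1].

   If c* <= 1/2, which is possible because X' and Y' need not be projective, a
   lower bound on c* is needed: every feasible value is at least half of
   sum_y tr(N_y^2 rho_A), that is (1 + b)/4 with b = tr(B^2 rho_A), whereas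
   beta <= 2 sqrt(1 + b) <= f((1 + b)/4).

   Part (ii) inverts the bound of part (i) on [0, 1]. *)
Require Import Defs.
From mathcomp Require Import all_boot all_order all_algebra.
From mathcomp Require Import classical_sets reals complex.
From mathcomp Require Import ring lra.
Set Implicit Arguments.
Unset Strict Implicit.
Unset Printing Implicit Defensive.
Import Order.TTheory GRing.Theory Num.Theory.
Local Open Scope ring_scope.
Local Open Scope sesquilinear_scope.

(** * Cauchy-Schwarz from the discriminant of a nonnegative quadratic form *)

Lemma quadratic_bound (R : realType) (a b c : R) :
  0 <= a -> 0 <= c ->
  (forall s t : R, 0 <= s ^+ 2 * a - 2 * s * t * b + t ^+ 2 * c) ->
  b <= Num.sqrt a * Num.sqrt c.
Proof.
move=> a0 c0 H; rewrite -sqrtrM //.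
have [b0|b0] := leP b 0; first by apply: le_trans b0 (sqrtr_ge0 _).
suff Hb : b ^+ 2 <= a * c.
  by rewrite -(ger0_norm (ltW b0)) -sqrtr_sqr ler_wsqrtr.
have [ca|ca] := eqVneq c 0.
  (* With c = 0 the form takes the value -(2 + a) b^2 at (b, 1 + a), which forces b = 0. *)
  by move: (H b (1 + a)); rewrite ca; nra.
have cp : 0 < c by rewrite lt_def ca.
(* At (c, b) the form equals c (a c - b^2). *)
have : 0 <= c * (c * a - b ^+ 2) by move: (H c b); nra.
by rewrite pmulr_rge0 // subr_ge0 mulrC.
Qed.

Lemma sum_sqrtM_le (R : realType) (I : finType) (a p : I -> R) :
  (forall i, 0 <= a i) -> (forall i, 0 <= p i) ->
  \sum_i Num.sqrt (a i) * Num.sqrt (p i)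
    <= Num.sqrt (\sum_i a i) * Num.sqrt (\sum_i p i).
Proof.
move=> a0 p0; apply: quadratic_bound; try exact: sumr_ge0.
move=> s t; rewrite !mulr_sumr -sumrB -big_split /=; apply: sumr_ge0 => i _.
rewrite -{1}(sqr_sqrtr (a0 i)) -{2}(sqr_sqrtr (p0 i)).
rewrite (_ : _ + _ = (s * Num.sqrt (a i) - t * Num.sqrt (p i)) ^+ 2) ?sqr_ge0 //.
by ring.
Qed.

(* [C], [toC] and [re] stand for [R[i]], the embedding of [R] and the real part.
   At this instance [psd], [ptr2], [opn], [overlap_value], and so on, are
   convertible to the definitions of the statement. *)
Section RealPart.
Variables (R : realType) (C : numClosedFieldType).
Variables (toC : {rmorphism R -> C}) (re : C -> R).
Hypothesis reD : {morph re : x y / x + y}.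
Hypothesis re_toCM : forall r x, re (toC r * x) = r * re x.
Hypothesis re_conj : forall x, re x^* = re x.
Hypothesis re_ge0 : forall x, 0 <= x -> 0 <= re x.
Hypothesis toC_ge0 : forall r, 0 <= r -> 0 <= toC r.
Hypothesis toC_re : forall x, x \is Num.real -> toC (re x) = x.

Lemma re0 : re 0 = 0.
Proof. by apply: (addIr (re 0)); rewrite -reD !add0r. Qed.

Lemma reN x : re (- x) = - re x.
Proof. by apply: (addIr (re x)); rewrite -reD !addNr re0. Qed.

Lemma re_sum (I : finType) (F : I -> C) : re (\sum_i F i) = \sum_i re (F i).
Proof. exact: (big_morph _ reD re0). Qed.

Lemma re1 : re 1 = 1.
Proof. by apply: (fmorph_inj toC); rewrite toC_re ?rpred1 // rmorph1. Qed.

Lemma re_toC r : re (toC r) = r.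
Proof. by rewrite -[toC r]mulr1 re_toCM re1 mulr1. Qed.

Lemma toC_conj r : (toC r)^* = toC r.
Proof.
apply/CrealP; case/orP: (le_total 0 r) => r0; first exact/ger0_real/toC_ge0.
by rewrite -realN -rmorphN; apply/ger0_real/toC_ge0; rewrite oppr_ge0.
Qed.

(** * Adjoints and positive semidefinite matrices *)

Lemma adjM m n p (A : 'M[C]_(m, n)) (B : 'M[C]_(n, p)) :
  (A *m B) ^t* = B ^t* *m A ^t*.
Proof. by rewrite trmx_mul map_mxM. Qed.

Lemma adjD m n (A B : 'M[C]_(m, n)) : (A + B) ^t* = A ^t* + B ^t*.
Proof. by rewrite linearD map_mxD. Qed.

Lemma adjN m n (A : 'M[C]_(m, n)) : (- A) ^t* = - A ^t*.
Proof. by rewrite linearN map_mxN. Qed.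

Lemma adjB m n (A B : 'M[C]_(m, n)) : (A - B) ^t* = A ^t* - B ^t*.
Proof. by rewrite adjD adjN. Qed.

Lemma adjZ m n (r : R) (A : 'M[C]_(m, n)) : (toC r *: A) ^t* = toC r *: A ^t*.
Proof. by apply/matrixP=> i j; rewrite !mxE rmorphM /= toC_conj. Qed.

Lemma adj1 n : (1%:M : 'M[C]_n) ^t* = 1%:M.
Proof. by rewrite trmx1 map_mx1. Qed.

Lemma adj_tens m n p q (A : 'M[C]_(m, n)) (B : 'M[C]_(p, q)) :
  (A *t B) ^t* = A ^t* *t B ^t*.
Proof. by rewrite mxtens.trmx_tens mxtens.map_mxT. Qed.

Lemma tr_adj n (A : 'M[C]_n) : \tr (A ^t*) = (\tr A)^*.
Proof. by rewrite trace_map_mx mxtrace_tr. Qed.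

Lemma gram_ge0 n (v : 'cV[C]_n) : 0 <= (v ^t* *m v) 0 0.
Proof.
rewrite mxE; apply: sumr_ge0 => i _; rewrite !mxE mulrC; exact: mul_conjC_ge0.
Qed.

Definition psd n (A : 'M[C]_n) := forall v : 'cV_n, 0 <= (v ^t* *m A *m v) 0 0.

Lemma psd_gram m n (F : 'M[C]_(m, n)) : psd (F ^t* *m F).
Proof. by move=> v; have := gram_ge0 (F *m v); rewrite adjM !mulmxA. Qed.

Lemma psd_conj m n (F : 'M[C]_(m, n)) (A : 'M[C]_m) :
  psd A -> psd (F ^t* *m A *m F).
Proof. by move=> hA v; have := hA (F *m v); rewrite adjM !mulmxA. Qed.

Lemma entry_form n (A : 'M[C]_n) i j :
  ((delta_mx i 0 : 'cV_n) ^t* *m A *m (delta_mx j 0 : 'cV_n)) 0 0 = A i j.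
Proof. by rewrite trmx_delta map_delta_mx -rowE -colE !mxE. Qed.

(** Polarization: the form is real at x + y and at x + i y, so the sum of the two cross terms is
    real and their difference is imaginary; basis vectors turn this into a relation between
    entries. *)
Lemma psd_herm n (A : 'M[C]_n) : psd A -> A ^t* = A.
Proof.
move=> hA; apply/matrixP => i j; rewrite mxE mxE.
pose q (x y : 'cV[C]_n) := (x ^t* *m A *m y) 0 0.
have qD x y : q (x + y) (x + y) = q x x + q y y + (q x y + q y x).
  by rewrite /q adjD 2!mulmxDl !mulmxDr !mxE; ring.
have qr x : (q x x)^* = q x x by apply/CrealP/ger0_real/hA.
have qZ x y : q x ('i *: y) + q ('i *: y) x = 'i * (q x y - q y x).
  rewrite /q (_ : ('i *: y) ^t* = - 'i *: y ^t*).
    by rewrite -!scalemxAl -scalemxAr !mxE; ring.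
  by apply/matrixP=> s t; rewrite !mxE rmorphM /= conjCi.
have cross x y : (q x y + q y x)^* = q x y + q y x.
  have -> : q x y + q y x = q (x + y) (x + y) - q x x - q y y.
    by rewrite qD; ring.
  by rewrite !rmorphB /= !qr.
have h1 := cross (delta_mx i 0) (delta_mx j 0).
have := cross (delta_mx i 0) ('i *: delta_mx j 0).
rewrite qZ rmorphM /= conjCi mulNr -mulrN => /(mulfI (neq0Ci _)).
move: h1; rewrite /q !entry_form => h1 h2.
have {}h1 : (A i j)^* + (A j i)^* = A i j + A j i by rewrite -rmorphD.
have {}h2 : (A j i)^* - (A i j)^* = A i j - A j i by rewrite -rmorphB -h2 -rmorphN opprB.
have e : 2 * (A j i)^* = 2 * A i j.
  transitivity (((A i j)^* + (A j i)^*) + ((A j i)^* - (A i j)^*)); first by ring.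
  by rewrite h1 h2; ring.
by apply: (mulfI _ e); rewrite pnatr_eq0.
Qed.

(** * Real functional calculus of Hermitian matrices *)

Definition real_diag n (l : 'I_n -> R) : 'M[C]_n := diag_mx (\row_j toC (l j)).

Lemma real_diagM n (k l : 'I_n -> R) :
  real_diag k *m real_diag l = real_diag (fun j => k j * l j).
Proof.
by rewrite mulmx_diag; congr diag_mx; apply/rowP => j; rewrite !mxE rmorphM.
Qed.

Lemma real_diagD n (k l : 'I_n -> R) :
  real_diag k + real_diag l = real_diag (fun j => k j + l j).
Proof.
by rewrite -linearD; congr diag_mx; apply/rowP => j; rewrite !mxE rmorphD.
Qed.

Lemma real_diag_const n (r : R) : real_diag (fun _ : 'I_n => r) = toC r *: 1%:M.
Proof.
by apply/matrixP => i j; rewrite !mxE; case: (i == j);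
  rewrite ?mulr1n ?mulr0n ?mulr1 ?mulr0.
Qed.

Lemma real_diag_adj n (l : 'I_n -> R) : (real_diag l) ^t* = real_diag l.
Proof.
apply/matrixP => i j; rewrite !mxE eq_sym; case: eqP => [->|_] /=.
  by rewrite !mulr1n toC_conj.
by rewrite !mulr0n rmorph0.
Qed.

(** The eigenvalues are taken in [R], so that square roots and comparisons of eigenvalues are those
    of the real field. *)
Lemma herm_spectral n (A : 'M[C]_n) : A ^t* = A ->
  exists (Q : 'M[C]_n) (l : 'I_n -> R),
    [/\ Q *m Q ^t* = 1%:M, Q ^t* *m Q = 1%:M &
        A = Q ^t* *m real_diag l *m Q].
Proof.
move=> hA.
have hsym : A \is hermsymmx by apply/is_hermitianmxP; rewrite scale1r; exact: esym hA.
have uQ := spectral_unitarymx A.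
have QQ : spectralmx A *m (spectralmx A) ^t* = 1%:M by apply/unitarymxP.
exists (spectralmx A), (fun j => re (spectral_diag A 0 j)); split=> //.
  exact: mulmx1C.
have /hermitian_normalmx /orthomx_spectralP {1}-> := hsym.
have e : \row_j toC (re (spectral_diag A 0 j)) = spectral_diag A.
  apply/rowP => j; rewrite mxE toC_re //.
  by have /mxOverP := hermitian_spectral_diag_real hsym; apply.
by rewrite /real_diag e invmx_unitary.
Qed.

Section Calculus.
Variables (n : nat) (Q : 'M[C]_n).
Hypotheses (QQ : Q *m Q ^t* = 1%:M) (QQ' : Q ^t* *m Q = 1%:M).

(** A function of an operator with eigenbasis [Q] is encoded by its values along the basis, indexed
    by [j]. *)
Definition spectral_fun (l : 'I_n -> R) : 'M[C]_n := Q ^t* *m real_diag l *m Q.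

Lemma eq_spectral_fun k l : k =1 l -> spectral_fun k = spectral_fun l.
Proof.
by move=> e; rewrite /spectral_fun (_ : real_diag k = real_diag l) //;
  apply/matrixP => i j; rewrite !mxE e.
Qed.

Lemma spectral_funM k l :
  spectral_fun k *m spectral_fun l = spectral_fun (fun j => k j * l j).
Proof.
rewrite /spectral_fun -real_diagM.
rewrite !mulmxA.
have e m (X : 'M[C]_(m, n)) : X *m Q *m Q ^t* = X.
  rewrite -mulmxA.
  rewrite QQ.
  exact: mulmx1.
by rewrite e.
Qed.

Lemma spectral_funD k l :
  spectral_fun k + spectral_fun l = spectral_fun (fun j => k j + l j).
Proof. by rewrite /spectral_fun -mulmxDl -mulmxDr real_diagD. Qed.

Lemma spectral_fun_const r : spectral_fun (fun _ => r) = toC r *: 1%:M.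
Proof.
by rewrite /spectral_fun real_diag_const -scalemxAr mulmx1 -scalemxAl QQ'.
Qed.

Lemma spectral_fun_adj l : (spectral_fun l) ^t* = spectral_fun l.
Proof. by rewrite /spectral_fun !adjM trmxCK real_diag_adj mulmxA. Qed.

Lemma spectral_fun_entry l j : (Q *m spectral_fun l *m Q ^t*) j j = toC (l j).
Proof.
rewrite /spectral_fun !mulmxA QQ mul1mx -mulmxA QQ mulmx1 !mxE eqxx.
by rewrite mulr1n.
Qed.

Lemma psd_spectral_fun_ge0 l : psd (spectral_fun l) -> forall j, 0 <= l j.
Proof.
move=> hA j; rewrite -(re_toC (l j)); apply: re_ge0.
rewrite -(spectral_fun_entry l j) -entry_form.
by have := psd_conj (Q ^t*) hA (delta_mx j 0); rewrite trmxCK.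
Qed.

End Calculus.

Lemma psd_factor n (A : 'M[C]_n) : psd A ->
  exists G : 'M[C]_n, A = G ^t* *m G.
Proof.
move=> hA; have [Q [l [QQ QQ' eA]]] := herm_spectral (psd_herm hA).
have l0 : forall j, 0 <= l j.
  by apply: (psd_spectral_fun_ge0 QQ); rewrite /spectral_fun -eA.
(* The witness is the positive square root of [A]. *)
exists (spectral_fun Q (fun j => Num.sqrt (l j))).
rewrite spectral_fun_adj (spectral_funM QQ) eA; apply: eq_spectral_fun => j.
by rewrite -expr2 sqr_sqrtr.
Qed.

Lemma half_double n (X : 'M[C]_n) : toC 2^-1 *: (X + X) = X.
Proof.
rewrite -mulr2n -scaler_nat scalerA -(rmorph_nat toC).
by rewrite -rmorphM mulVf ?pnatr_eq0 // rmorph1 scale1r.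
Qed.

(** * Binary measurements and their observables *)

Definition observable n (M : bool -> 'M[C]_n) := M false - M true.

Definition measurement n (M : bool -> 'M[C]_n) :=
  (forall x, psd (M x)) /\ \sum_x M x = 1%:M.

(** The observable O is a contraction, and [S] is the positive square root of 1 - O^2. Taken in the
    same eigenbasis it commutes with O. It completes O to a reflection in the Halmos dilation and is
    the defect in estimates of tensor products. *)
Lemma measurement_observable n (M : bool -> 'M[C]_n) : measurement M ->
  [/\ M false = toC 2^-1 *: (1%:M + observable M),
      M true = toC 2^-1 *: (1%:M - observable M),
      (observable M) ^t* = observable M &
      exists S : 'M[C]_n, [/\ S ^t* = S, S *m observable M = observable M *m S &
        observable M *m observable M + S *m S = 1%:M]].
Proof.
move=> [hM sM]; have {}sM : M true + M false = 1%:M by rewrite -sM big_bool.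
have ht : (M true) ^t* = M true by apply: psd_herm.
have [Q [l [QQ QQ' eA]]] := herm_spectral ht.
rewrite -/(spectral_fun Q l) in eA.
(* The spelling [1 + (- 1) * l j] follows the shape of [spectral_funD] and [spectral_funM]. *)
have eF : M false = spectral_fun Q (fun j => 1 + (- 1) * l j).
  rewrite -spectral_funD // -spectral_funM // !spectral_fun_const //.
  rewrite -scalemxAl mul1mx -eA rmorphN rmorph1 scale1r scaleN1r -sM.
  by rewrite addrAC subrr add0r.
have l0 : forall j, 0 <= l j.
  by apply: (psd_spectral_fun_ge0 QQ); rewrite -eA.
have l1 : forall j, 0 <= 1 + (- 1) * l j.
  by apply: (psd_spectral_fun_ge0 QQ); rewrite -eF.
have eO : observable M = spectral_fun Q (fun j => 1 + (- 2) * l j).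
  rewrite /observable eF -!spectral_funD // -!spectral_funM // !spectral_fun_const //.
  rewrite -!scalemxAl mul1mx -eA -addrA; congr (_ + _).
  rewrite -[X in _ - X]scale1r -scalerBl -(rmorph1 toC) -rmorphB.
  by congr (toC _ *: _); ring.
split.
- by rewrite /observable -sM (addrC (M true)) addrACA subrr addr0 half_double.
- by rewrite /observable -sM opprB addrACA subrr addr0 half_double.
- by rewrite eO spectral_fun_adj.
(* 4 l (1 - l) = 1 - (1 - 2 l)^2, where 1 - 2 l is the eigenvalue of the observable. *)
pose S := spectral_fun Q (fun j => Num.sqrt (4 * (l j * (1 + (- 1) * l j)))).
exists S; split; first exact: spectral_fun_adj.
  rewrite eO !(spectral_funM QQ); apply: eq_spectral_fun => j.
  exact: mulrC.
rewrite eO !(spectral_funM QQ) spectral_funD.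
rewrite -[RHS]scale1r -[X in _ = X *: _](rmorph1 toC) -(spectral_fun_const QQ').
apply: eq_spectral_fun => j; rewrite -(expr2 (Num.sqrt _)) sqr_sqrtr.
  by ring.
by rewrite !mulr_ge0.
Qed.

(** * Expectations and Cauchy-Schwarz for operators *)

Definition expect n (rho X : 'M[C]_n) : R := re (\tr (X *m rho)).

Lemma expectD n (rho X Y : 'M[C]_n) :
  expect rho (X + Y) = expect rho X + expect rho Y.
Proof. by rewrite /expect mulmxDl linearD reD. Qed.

Lemma expectN n (rho X : 'M[C]_n) : expect rho (- X) = - expect rho X.
Proof. by rewrite /expect mulNmx linearN reN. Qed.

Lemma expectB n (rho X Y : 'M[C]_n) :
  expect rho (X - Y) = expect rho X - expect rho Y.
Proof. by rewrite expectD expectN. Qed.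

Lemma expectZ n (rho X : 'M[C]_n) (r : R) :
  expect rho (toC r *: X) = r * expect rho X.
Proof. by rewrite /expect -scalemxAl linearZ re_toCM. Qed.

Lemma expect_sum n (rho : 'M[C]_n) (I : finType) (X : I -> 'M[C]_n) :
  expect rho (\sum_i X i) = \sum_i expect rho (X i).
Proof.
apply: (big_morph (expect rho) (@expectD _ rho)).
by rewrite /expect mul0mx mxtrace0 re0.
Qed.

Definition state n (rho : 'M[C]_n) := psd rho /\ \tr rho = 1.

Lemma expect1 n (rho : 'M[C]_n) : state rho -> expect rho 1%:M = 1.
Proof. by case=> _; rewrite /expect mul1mx => ->; exact: re1. Qed.

Lemma expect_conj m n (rho : 'M[C]_n) (U : 'M[C]_(m, n)) (X : 'M[C]_m) :
  expect rho (U ^t* *m X *m U) = re (\tr (X *m U *m rho *m U ^t*)).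
Proof. by rewrite /expect [in RHS]mxtrace_mulC !mulmxA. Qed.

(** This reduces traces to values of a quadratic form at vectors, where positivity and the operator
    norm give estimates. *)
Lemma tr_conj_rows m n (F : 'M[C]_(m, n)) (A : 'M[C]_n) :
  \tr (F *m A *m F ^t*) =
    \sum_i (((row i F) ^t*) ^t* *m A *m (row i F) ^t*) 0 0.
Proof.
apply: eq_bigr => i _; rewrite trmxCK -row_mul mxE [in RHS]mxE.
by apply: eq_bigr => j _; congr (_ * _); rewrite !mxE.
Qed.

Lemma tr_gram_ge0 m n (rho : 'M[C]_n) (F : 'M[C]_(m, n)) :
  psd rho -> 0 <= \tr (F ^t* *m F *m rho).
Proof.
move=> hrho; rewrite -mulmxA mxtrace_mulC tr_conj_rows.
by apply: sumr_ge0 => i _; apply: hrho.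
Qed.

Lemma expect_gram_ge0 m n (rho : 'M[C]_n) (F : 'M[C]_(m, n)) :
  psd rho -> 0 <= expect rho (F ^t* *m F).
Proof. by move=> hrho; apply/re_ge0/tr_gram_ge0. Qed.

Lemma expect_adj n (rho X : 'M[C]_n) :
  psd rho -> expect rho (X ^t*) = expect rho X.
Proof.
move=> /psd_herm hrho.
have e : (rho *m X) ^t* = X ^t* *m rho by rewrite adjM hrho.
by rewrite /expect -e tr_adj mxtrace_mulC; apply: re_conj.
Qed.

Lemma expect_gramB m n (rho : 'M[C]_n) (F G : 'M[C]_(m, n)) :
  expect rho ((F - G) ^t* *m (F - G)) =
    expect rho (F ^t* *m F) - expect rho (F ^t* *m G)
      - (expect rho (G ^t* *m F) - expect rho (G ^t* *m G)).
Proof. by rewrite adjB mulmxBl !mulmxBr !expectB. Qed.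

Lemma expect_gramZ m n (rho : 'M[C]_n) (s t : R) (F G : 'M[C]_(m, n)) :
  expect rho ((toC s *: F) ^t* *m (toC t *: G)) = s * (t * expect rho (F ^t* *m G)).
Proof. by rewrite adjZ -scalemxAl -scalemxAr 2!expectZ. Qed.

Lemma expect_gramC m n (rho : 'M[C]_n) (F G : 'M[C]_(m, n)) :
  psd rho -> expect rho (G ^t* *m F) = expect rho (F ^t* *m G).
Proof. by move=> hrho; rewrite -expect_adj // adjM trmxCK. Qed.

(** The expectation of F^* G is a symmetric positive semidefinite real form in F and G; its value at
    s F - t G is the quadratic form in s and t of [quadratic_bound]. *)
Lemma expect_CauchySchwarz m n (rho : 'M[C]_n) (F G : 'M[C]_(m, n)) :
  psd rho ->
  expect rho (F ^t* *m G) <=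
    Num.sqrt (expect rho (F ^t* *m F)) * Num.sqrt (expect rho (G ^t* *m G)).
Proof.
move=> hrho; apply: quadratic_bound; try exact: expect_gram_ge0.
move=> s t; have := expect_gram_ge0 (toC s *: F - toC t *: G) hrho.
rewrite expect_gramB !expect_gramZ (expect_gramC F G hrho).
by congr (_ <= _); ring.
Qed.

(** * Partial trace and tensor products *)

Definition ptr2 a d (rho : 'M[C]_(a * d)) : 'M[C]_a :=
  \matrix_(i, j) \sum_(k < d)
    rho (mxtens.mxtens_index (i, k)) (mxtens.mxtens_index (j, k)).

Lemma sum_mxtens_index a d (F : 'I_(a * d) -> C) :
  \sum_x F x = \sum_i \sum_k F (mxtens.mxtens_index (i, k)).
Proof.
rewrite (reindex (@mxtens.mxtens_index a d)) /=; last first.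
  exists (@mxtens.mxtens_unindex a d) => x _.
    exact: mxtens.mxtens_indexK.
  exact: mxtens.mxtens_unindexK.
by rewrite pair_bigA; apply: eq_bigr => [[i k]] _.
Qed.

(** The identity on the second factor keeps only the terms whose two indices there agree, which is
    the sum defining the partial trace. *)
Lemma tr_ptr2 a d (rho : 'M[C]_(a * d)) (Y : 'M[C]_a) :
  \tr ((Y *t (1%:M : 'M_d)) *m rho) = \tr (Y *m ptr2 rho).
Proof.
rewrite /mxtrace sum_mxtens_index; apply: eq_bigr => i _.
rewrite mxE; under eq_bigr => k _.
  rewrite mxE sum_mxtens_index; under eq_bigr => j _.
    rewrite (bigD1 k) //= mxtens.tensmxE big1; last first.
      move=> l lk; rewrite mxtens.tensmxE mxE eq_sym (negbTE lk).
      by rewrite mulr0 mul0r.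
    rewrite mxE eqxx mulr1 addr0.
    over.
  over.
rewrite exchange_big; apply: eq_bigr => j _ /=.
by rewrite mxE mulr_sumr.
Qed.

Lemma expect_ptr2 a d (rho : 'M[C]_(a * d)) (Y : 'M[C]_a) :
  expect rho (Y *t (1%:M : 'M_d)) = expect (ptr2 rho) Y.
Proof. by rewrite /expect tr_ptr2. Qed.

Lemma tensmx11 a d : (1%:M : 'M[C]_a) *t (1%:M : 'M[C]_d) = 1%:M.
Proof.
apply/matrixP => i j; rewrite !mxE.
case: (mxtens.mxtens_indexP i) => i1 i2; case: (mxtens.mxtens_indexP j) => j1 j2.
rewrite !mxtens.mxtens_indexK /= -natrM mulnb; congr (_%:R); congr nat_of_bool.
by rewrite (can_eq (@mxtens.mxtens_indexK _ _)).
Qed.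

Lemma ptr2_state a d (rho : 'M[C]_(a * d)) :
  state rho -> state (ptr2 rho).
Proof.
move=> [hrho trho]; split=> [v|]; last first.
  by rewrite -[ptr2 rho]mul1mx -tr_ptr2 tensmx11 mul1mx.
(* The Gram matrix of v^* (x) 1 is v v^* (x) 1, and its trace against [rho] is the form of the
   partial trace at v. *)
have := tr_gram_ge0 ((v ^t*) *t (1%:M : 'M_d)) hrho.
rewrite adj_tens trmxCK adj1 mxtens.tensmx_mul mul1mx tr_ptr2.
by rewrite -[v *m _ *m _]mulmxA mxtrace_mulC trace_mx11.
Qed.

(* [(W ^t* *m W) *t (S *m S)] is the defect of replacing [Rm *m Rm] by 1. *)
Lemma expect_tens_observable_le a d m (rho : 'M[C]_(a * d)) (Y W : 'M[C]_(m, a))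
    (Rm S : 'M[C]_d) :
  psd rho -> Rm ^t* = Rm -> S ^t* = S -> Rm *m Rm + S *m S = 1%:M ->
  expect rho ((Y ^t* *m W) *t Rm) <=
    Num.sqrt (expect (ptr2 rho) (Y ^t* *m Y)) *
    Num.sqrt (expect (ptr2 rho) (W ^t* *m W)).
Proof.
move=> hrho hR hS RS.
have -> : (Y ^t* *m W) *t Rm = (Y *t (1%:M : 'M_d)) ^t* *m (W *t Rm).
  by rewrite adj_tens mxtens.tensmx_mul adj1 mul1mx.
apply: le_trans (expect_CauchySchwarz _ _ hrho) _.
rewrite !adj_tens !mxtens.tensmx_mul adj1 mul1mx hR expect_ptr2.
apply: ler_wpM2l; first exact: sqrtr_ge0.
apply: ler_wsqrtr; rewrite -(expect_ptr2 rho) -subr_ge0 -expectB.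
suff -> : (W ^t* *m W) *t 1%:M - (W ^t* *m W) *t (Rm *m Rm)
    = (W *t S) ^t* *m (W *t S) by apply: expect_gram_ge0.
rewrite adj_tens mxtens.tensmx_mul hS -RS.
by apply/matrixP => i j; rewrite !mxE mulrDr addrAC subrr add0r.
Qed.

(** * The CHSH value in terms of observables *)

Definition chsh_value a d (rho : 'M[C]_(a * d)) (M N : bool -> 'M[C]_a)
    (Rm Sm : bool -> 'M[C]_d) : R :=
  2 * re (\tr ((\sum_(i : bool)
         (M i *t (Rm i + Sm i) + N i *t (Rm i + Sm (~~ i)))) *m rho)) - 4.

(** Each of the four sums of products of outcomes is half of the identity plus or minus a product of
    observables. The offset 4 cancels the identities, and the rest is grouped by the observables on
    the second factor. *)
Lemma chshE a d (rho : 'M[C]_(a * d)) (M N : bool -> 'M[C]_a)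
    (Rm Sm : bool -> 'M[C]_d) :
  state rho -> measurement M -> measurement N ->
  measurement Rm -> measurement Sm ->
  chsh_value rho M N Rm Sm =
    expect rho ((observable M + observable N) *t observable Rm) +
    expect rho ((observable M - observable N) *t observable Sm).
Proof.
move=> hrho hM hN hR hS; rewrite /chsh_value big_bool /=.
have [-> -> _ _] := measurement_observable hM.
have [-> -> _ _] := measurement_observable hN.
have [-> -> _ _] := measurement_observable hR.
have [-> -> _ _] := measurement_observable hS.
move: (observable M) (observable N) (observable Rm) (observable Sm) => A B X Y.
set h : C := toC _.
have h2 : 2 * h = 1.
  by rewrite -(rmorph_nat toC) -rmorphM mulfV ?pnatr_eq0 // rmorph1.
set T := (X in \tr (X *m rho)).
have -> : T = toC 2^-1 *: (toC 4 *: 1%:M + (A + B) *t X + (A - B) *t Y).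
  apply/matrixP => i j; rewrite /T.
  rewrite -tensmx11 !mxE -/h (rmorph_nat toC 4).
  (* The left-hand side is quadratic in h and the right-hand side linear; the factor 2 h = 1
     balances them for [ring]. *)
  set x := (X in _ = X); transitivity (2 * h * x); last by rewrite h2 mul1r.
  by rewrite /x; ring.
rewrite -/(expect rho _) expectZ !expectD expectZ expect1 //.
by field.
Qed.

(** * The operator norm *)

Definition sqn n (v : 'cV[C]_n) : R := re ((v ^t* *m v) 0 0).

Definition l2 n (v : 'cV[C]_n) : R := Num.sqrt (sqn v).

Definition opn n (A : 'M[C]_n) : R :=
  sup [set l2 (A *m v) | v in [set v : 'cV[C]_n | l2 v <= 1]]%classic.

Lemma sqn_ge0 n (v : 'cV[C]_n) : 0 <= sqn v.
Proof. exact/re_ge0/gram_ge0. Qed.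

Lemma re_inner_le n (u v : 'cV[C]_n) : re ((u ^t* *m v) 0 0) <= l2 u * l2 v.
Proof.
have h1 : psd (1%:M : 'M[C]_1) by move=> w; rewrite mulmx1; exact: gram_ge0.
by have := expect_CauchySchwarz u v h1; rewrite /expect !mulmx1 !trace_mx11.
Qed.

Lemma l2_triangle n (u v : 'cV[C]_n) : l2 (u + v) <= l2 u + l2 v.
Proof.
rewrite -[X in _ <= X]ger0_norm ?addr_ge0 ?sqrtr_ge0 // -sqrtr_sqr.
apply: ler_wsqrtr; rewrite sqrrD !sqr_sqrtr ?sqn_ge0 //.
have -> : sqn (u + v) = sqn u + 2 * re ((u ^t* *m v) 0 0) + sqn v.
  have mxD (A B : 'M[C]_1) : (A + B) 0 0 = A 0 0 + B 0 0 by rewrite mxE.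
  rewrite /sqn adjD mulmxDl !mulmxDr !mxD !reD.
  have -> : re ((v ^t* *m u) 0 0) = re ((u ^t* *m v) 0 0).
    have -> : v ^t* *m u = (u ^t* *m v) ^t* by rewrite adjM trmxCK.
    by rewrite [LHS]/= mxE mxE re_conj.
  by ring.
by rewrite lerD2r lerD2l mulr_natl !mulr2n lerD ?re_inner_le.
Qed.

Lemma sqnZ n (r : R) (v : 'cV[C]_n) : sqn (toC r *: v) = r ^+ 2 * sqn v.
Proof.
by rewrite /sqn adjZ -scalemxAl -scalemxAr scalerA mxE -rmorphM re_toCM expr2.
Qed.

(** Diagonalizing A^* A yields the sum of the absolute eigenvalues as a bound. It makes the set in
    [opn] bounded, so that its supremum is an upper bound. *)
Lemma sqn_mul_bounded m n (A : 'M[C]_(m, n)) :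
  exists2 K, 0 <= K & forall v, sqn (A *m v) <= K * sqn v.
Proof.
have hA : (A ^t* *m A) ^t* = A ^t* *m A by rewrite adjM trmxCK.
have [Q [l [QQ QQ' eA]]] := herm_spectral hA.
exists (\sum_i `|l i|) => [|v]; first exact: sumr_ge0.
have -> : sqn v = sqn (Q *m v).
  by rewrite /sqn adjM -mulmxA (mulmxA _ Q) QQ' mul1mx.
have -> : sqn (A *m v) = \sum_j l j * re (((Q *m v) j 0)^* * (Q *m v) j 0).
  rewrite /sqn adjM -mulmxA (mulmxA _ A) eA -2!mulmxA mulmxA.
  rewrite -[v ^t* *m Q ^t*]adjM mxE re_sum; apply: eq_bigr => j _.
  by rewrite /real_diag mul_diag_mx !mxE mulrCA re_toCM.
rewrite /sqn mxE re_sum mulr_sumr; apply: ler_sum => j _.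
rewrite !mxE; apply: ler_wpM2r.
  by apply: re_ge0; rewrite mulrC mul_conjC_ge0.
apply: le_trans (ler_norm _) _.
by rewrite (bigD1 j) //= lerDl sumr_ge0.
Qed.

Lemma l2_mul_le_opn n (A : 'M[C]_n) (v : 'cV[C]_n) :
  l2 v <= 1 -> l2 (A *m v) <= opn A.
Proof.
move=> v1; apply: ub_le_sup; last by exists v.
have [K K0 hK] := sqn_mul_bounded A; exists (Num.sqrt K) => _ [w w1 <-].
rewrite /l2; apply: le_trans (ler_wsqrtr (hK w)) _.
by rewrite sqrtrM // ler_piMr // sqrtr_ge0.
Qed.

Lemma opn_ge0 n (A : 'M[C]_n) : 0 <= opn A.
Proof.
have z : l2 (0 : 'cV[C]_n) <= 1 by rewrite /l2 /sqn mulmx0 mxE re0 sqrtr0.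
exact: le_trans (sqrtr_ge0 _) (l2_mul_le_opn A z).
Qed.

Lemma opn_le n (A : 'M[C]_n) (c : R) :
  0 <= c -> (forall v, sqn v <= 1 -> l2 (A *m v) <= c) -> opn A <= c.
Proof.
move=> c0 hA; apply: ge_sup.
  exists (l2 (A *m 0)), 0 => //=.
  by rewrite /l2 /sqn mulmx0 mxE re0 sqrtr0.
move=> _ [v v1 <-]; apply: hA; rewrite -(sqr_sqrtr (sqn_ge0 v)).
by rewrite exprn_ile1 // sqrtr_ge0.
Qed.

(** Cauchy-Schwarz, then normalization of v, since the supremum in [opn] runs over the unit ball;
    the zero vector is treated apart. *)
Lemma re_form_le_opn n (A : 'M[C]_n) (v : 'cV[C]_n) :
  re ((v ^t* *m A *m v) 0 0) <= opn A * sqn v.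
Proof.
rewrite -mulmxA; apply: le_trans (re_inner_le _ _) _.
have [v0|v0] := eqVneq (l2 v) 0.
  by rewrite v0 mul0r mulr_ge0 ?opn_ge0 ?sqn_ge0.
have vp : 0 < l2 v by rewrite lt_def v0 sqrtr_ge0.
have e : sqn v = l2 v ^+ 2 by rewrite sqr_sqrtr ?sqn_ge0.
pose w := toC (l2 v)^-1 *: v.
have w1 : l2 w <= 1.
  by rewrite /l2 sqnZ e -exprMn mulVf // expr1n sqrtr1.
have := l2_mul_le_opn A w1.
rewrite /l2 -scalemxAr sqnZ sqrtrM ?sqr_ge0 // sqrtr_sqr ger0_norm; last first.
  by rewrite invr_ge0 ltW.
rewrite ler_pdivrMl // => h; apply: le_trans (ler_wpM2l (ltW vp) h) _.
by rewrite e le_eqVlt; apply/orP; left; apply/eqP; ring.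
Qed.

(** Hölder duality of trace and operator norm: a factorization S = G^* G splits both traces over the
    rows of G. *)
Lemma re_tr_psd_le_opn n (A S : 'M[C]_n) :
  psd S -> re (\tr (A *m S)) <= opn A * re (\tr S).
Proof.
move=> /psd_factor[G ->].
have -> : \tr (A *m (G ^t* *m G)) = \tr (G *m A *m G ^t*).
  by rewrite mulmxA mxtrace_mulC mulmxA.
have -> : \tr (G ^t* *m G) = \tr (G *m 1%:M *m G ^t*).
  by rewrite mulmx1 mxtrace_mulC.
rewrite !tr_conj_rows !re_sum mulr_sumr; apply: ler_sum => i _.
by rewrite mulmx1; apply: re_form_le_opn.
Qed.

(** * A lower bound on every feasible value *)

Definition projective_measurement n r (P : 'I_r -> 'M[C]_n) :=
  ((forall k, psd (P k)) /\ \sum_k P k = 1%:M) /\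
  forall k, (P k) ^t* = P k /\ P k *m P k = P k.

Definition feasible a (M N : bool -> 'M[C]_a) (a' r : nat)
    (U : 'M[C]_(a', a)) (M' N' : bool -> 'M[C]_a') (P : 'I_r -> 'M[C]_a') :=
  [/\ U ^t* *m U = 1%:M, measurement M', measurement N',
      projective_measurement P &
      (forall x, \sum_k U ^t* *m P k *m M' x *m P k *m U = M x) /\
      (forall y, \sum_k U ^t* *m P k *m N' y *m P k *m U = N y)].

Definition overlap_value a (rho : 'M[C]_a) (a' r : nat)
    (U : 'M[C]_(a', a)) (M' N' : bool -> 'M[C]_a') (P : 'I_r -> 'M[C]_a') : R :=
  \sum_k re (\tr (P k *m U *m rho *m U ^t*)) *
    \big[Num.max/0]_x opn (\sum_y
      (P k *m N' y *m P k) *m (P k *m M' x *m P k) *m (P k *m N' y *m P k)).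

(* Sum the squares of the [Q k *m U - P k *m U *m N] over [k]. *)
Lemma expect_sq_le_pinched a a' r (rho : 'M[C]_a) (U : 'M[C]_(a', a))
    (P Q : 'I_r -> 'M[C]_a') (N : 'M[C]_a) :
  psd rho -> N ^t* = N -> U ^t* *m U = 1%:M -> projective_measurement P ->
  (forall k, (Q k) ^t* = Q k) -> (forall k, Q k *m P k = Q k) ->
  \sum_k U ^t* *m Q k *m U = N ->
  expect rho (N *m N) <= \sum_k expect rho ((Q k *m U) ^t* *m (Q k *m U)).
Proof.
move=> hrho hN hU [[_ sP] hP] hQ QP sQ.
have : 0 <= \sum_k expect rho ((Q k *m U - P k *m U *m N) ^t* *m
                               (Q k *m U - P k *m U *m N)).
  by apply: sumr_ge0 => k _; apply: expect_gram_ge0.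
have FG k : expect rho ((Q k *m U) ^t* *m (P k *m U *m N)) =
            expect rho (U ^t* *m Q k *m U *m N).
  by rewrite adjM hQ !mulmxA -(mulmxA _ (Q k)) QP.
have GG k : expect rho ((P k *m U *m N) ^t* *m (P k *m U *m N)) =
            expect rho (N *m (U ^t* *m P k *m U) *m N).
  have [hPk PP] := hP k.
  by rewrite !adjM hPk hN !mulmxA -(mulmxA _ (P k) (P k)) PP.
under eq_bigr => k _ do
  rewrite expect_gramB (expect_gramC (Q k *m U) _ hrho) FG GG.
rewrite !sumrB -!expect_sum -mulmx_suml sQ -mulmx_suml -mulmx_sumr.
rewrite -mulmx_suml -mulmx_sumr sP mulmx1 hU mulmx1.
by rewrite subrr subr0 subr_ge0.
Qed.

(** The maximum over the two outcomes x is at least the average, whence the factor 1/2. Summed over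
    x, the middle factors collapse to P because the [M' x] add up to the identity; only the squares
    of the [Q y] remain. *)
Lemma block_overlap_ge a a' (rho : 'M[C]_a) (U : 'M[C]_(a', a))
    (M' Q : bool -> 'M[C]_a') (P : 'M[C]_a') :
  psd rho -> \sum_x M' x = 1%:M -> P ^t* = P -> P *m P = P ->
  (forall y, (Q y) ^t* = Q y) -> (forall y, Q y *m P = Q y) ->
  2^-1 * \sum_y expect rho ((Q y *m U) ^t* *m (Q y *m U)) <=
    re (\tr (P *m U *m rho *m U ^t*)) *
    \big[Num.max/0]_x opn (\sum_y Q y *m (P *m M' x *m P) *m Q y).
Proof.
move=> hrho sM' hP PP hQ QP.
have PQ y : P *m Q y = Q y by rewrite -(hQ y) -{1}hP -adjM QP.
pose T x := \sum_y Q y *m (P *m M' x *m P) *m Q y.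
set p := re _; set m := \big[Num.max/0]_x _.
pose S := P *m U *m rho *m (P *m U) ^t*.
have hS : psd S by have := psd_conj ((P *m U) ^t*) hrho; rewrite trmxCK.
have trS : re (\tr S) = p by rewrite /p /S adjM hP mulmxA mxtrace_mulC !mulmxA PP.
have p0 : 0 <= p.
  have e := expect_conj rho (P *m U) 1%:M; rewrite mulmx1 mul1mx in e.
  by rewrite -trS /S -e; apply: expect_gram_ge0.
have Tm x : re (\tr (T x *m S)) <= p * m.
  apply: le_trans (re_tr_psd_le_opn _ hS) _; rewrite trS mulrC.
  by apply: ler_wpM2l => //; apply: (le_bigmax _ (fun x => opn (T x))).
have sT : \sum_x T x = \sum_y Q y *m Q y.
  rewrite /T exchange_big; apply: eq_bigr => y _ /=.
  rewrite -mulmx_suml -mulmx_sumr -mulmx_suml -mulmx_sumr sM' mulmx1 PP.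
  by rewrite QP.
have -> : \sum_y expect rho ((Q y *m U) ^t* *m (Q y *m U)) =
    \sum_x re (\tr (T x *m S)).
  rewrite -[RHS]re_sum -linear_sum -mulmx_suml sT mulmx_suml linear_sum re_sum.
  apply: eq_bigr => y _.
  have -> : (Q y *m U) ^t* *m (Q y *m U)
      = (P *m U) ^t* *m (Q y *m Q y) *m (P *m U).
    by rewrite !adjM hQ hP !mulmxA -(mulmxA _ P (Q y)) PQ -(mulmxA _ (Q y) P) QP.
  by rewrite expect_conj /S !mulmxA.
rewrite ler_pdivrMl ?ltr0n //; apply: le_trans (ler_sum _ (fun x _ => Tm x)) _.
by rewrite sumr_const card_bool mulr_natl.
Qed.

(** The block bounds are summed over k with the pinched elements P N' P as [Q];
    [expect_sq_le_pinched], an inequality of Kadison type, then passes from these blocks to N. *)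
Lemma overlap_value_ge a (rho : 'M[C]_a) (M N : bool -> 'M[C]_a) (a' r : nat)
    (U : 'M[C]_(a', a)) (M' N' : bool -> 'M[C]_a') (P : 'I_r -> 'M[C]_a') :
  psd rho -> measurement N -> feasible M N U M' N' P ->
  2^-1 * \sum_y expect rho (N y *m N y) <= overlap_value rho U M' N' P.
Proof.
move=> hrho [hN _] [hU [_ sM'] [hN' _] hP [_ sN]].
have [_ hPk] := hP.
pose Q k y := P k *m N' y *m P k.
have hQ k y : (Q k y) ^t* = Q k y.
  by rewrite /Q !adjM (hPk k).1 (psd_herm (hN' y)) mulmxA.
have QP k y : Q k y *m P k = Q k y by rewrite /Q -mulmxA (hPk k).2.
have key k := block_overlap_ge U hrho sM' (hPk k).1 (hPk k).2 (hQ k) (QP k).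
apply: le_trans (ler_sum _ (fun k _ => key k)).
rewrite -mulr_sumr exchange_big ler_pM2l ?invr_gt0 ?ltr0n //.
apply: ler_sum => y _.
apply: (expect_sq_le_pinched (Q := fun k => Q k y) hrho (psd_herm (hN y)) hU hP) => //.
by rewrite -sN; apply: eq_bigr => k _; rewrite /Q !mulmxA.
Qed.

(** * Spectral projectors and commutation *)

Lemma spectral_fun_comm n (Q X : 'M[C]_n) (l f : 'I_n -> R) :
  Q *m Q ^t* = 1%:M -> Q ^t* *m Q = 1%:M ->
  (forall i j, l i = l j -> f i = f j) ->
  X *m spectral_fun Q l = spectral_fun Q l *m X ->
  X *m spectral_fun Q f = spectral_fun Q f *m X.
Proof.
move=> QQ QQ' lf cX; pose Y := Q *m X *m Q ^t*.
have eX : X = Q ^t* *m Y *m Q.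
  by rewrite /Y !mulmxA QQ' mul1mx -mulmxA QQ' mulmx1.
have XQ g : X *m spectral_fun Q g = Q ^t* *m (Y *m real_diag g) *m Q.
  by rewrite eX /spectral_fun !mulmxA -(mulmxA _ Q (Q ^t*)) QQ mulmx1.
have QX g : spectral_fun Q g *m X = Q ^t* *m (real_diag g *m Y) *m Q.
  by rewrite eX /spectral_fun !mulmxA -(mulmxA _ Q (Q ^t*)) QQ mulmx1.
have cY : Y *m real_diag l = real_diag l *m Y.
  have e Z : Z = Q *m (Q ^t* *m Z *m Q) *m Q ^t*.
    by rewrite !mulmxA QQ mul1mx -mulmxA QQ mulmx1.
  by rewrite (e (Y *m _)) (e (_ *m Y)) -XQ -QX cX.
rewrite XQ QX; congr (_ *m _ *m _); apply/matrixP => i j.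
(* Entrywise, commuting with diag l means that Y i j vanishes unless l i = l j, and in that case f i
   = f j. *)
have := congr1 (fun Z : 'M[C]_n => Z i j) cY.
rewrite /real_diag !mul_mx_diag !mul_diag_mx !mxE.
have [lij|lij] := eqVneq (l i) (l j).
  by move=> _; rewrite (lf _ _ lij) mulrC.
move/eqP; rewrite mulrC -subr_eq0 -mulrBl -rmorphB mulf_eq0 fmorph_eq0.
by rewrite subr_eq0 eq_sym (negbTE lij) => /eqP->; rewrite mulr0 mul0r.
Qed.

Lemma spectral_resolution n (H : 'M[C]_n) : H ^t* = H ->
  exists (r : nat) (P : 'I_r -> 'M[C]_n) (l : 'I_r -> R),
    [/\ projective_measurement P,
        forall k, H *m P k = toC (l k) *: P k &
        forall X, X *m H = H *m X -> forall k, X *m P k = P k *m X].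
Proof.
move=> hH; have [Q [lam [QQ QQ' eH]]] := herm_spectral hH.
rewrite -/(spectral_fun Q lam) in eH.
(* Removing duplicates makes each projector cover a full eigenspace; a projector onto part of one
   need not commute with all that commutes with [H]. *)
pose s := undup [seq lam i | i <- enum 'I_n].
pose l (k : 'I_(size s)) := s`_k.
pose P k := spectral_fun Q (fun j => (lam j == l k)%:R).
have hP k : (P k) ^t* = P k by exact: spectral_fun_adj.
have PP k : P k *m P k = P k.
  rewrite (spectral_funM QQ); apply: eq_spectral_fun => j.
  by rewrite -natrM mulnb andbb.
exists (size s), P, l; split=> [|k|X cX k].
- split=> [|//]; split=> [k|].
    by rewrite -PP -{1}hP; exact: psd_gram.
  rewrite -mulmx_suml -mulmx_sumr.
  suff -> : \sum_k real_diag (fun j => (lam j == l k)%:R) = 1%:M.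
    by rewrite mulmx1.
  apply/matrixP => i j; rewrite summxE.
  have js : lam j \in s by rewrite mem_undup map_f // mem_enum.
  have jlt : (index (lam j) s < size s)%N by rewrite index_mem.
  rewrite (bigD1 (Ordinal jlt)) //= big1 ?addr0.
    by rewrite !mxE /l /= nth_index //; case: (i =P j) => [->|_];
      rewrite ?eqxx ?rmorph1 ?mulr0n ?mulr1n.
  move=> k kj; rewrite !mxE.
  case: (i =P j) => [->|_]; rewrite ?mulr0n // mulr1n.
  case: eqP => [e|_]; last by rewrite rmorph0.
  case/eqP: kj; apply: val_inj => /=.
  by rewrite e /l index_uniq ?undup_uniq.
- rewrite eH (spectral_funM QQ) -[_ *: P k]mul1mx -scalemxAr scalemxAl.
  rewrite -(spectral_fun_const QQ') (spectral_funM QQ).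
  apply: eq_spectral_fun => j /=.
  by case: eqP => [->|_]; rewrite ?mulr0.
- rewrite eH in cX; apply: spectral_fun_comm cX => // i j e.
  by rewrite e.
Qed.

(** * Halmos dilations of contractions to reflections *)

Section Halmos.
Variables (n : nat) (A S : 'M[C]_n).
Hypotheses (hA : A ^t* = A) (hS : S ^t* = S).
Hypotheses (cSA : S *m A = A *m S) (AS : A *m A + S *m S = 1%:M).

Definition halmos : 'M[C]_(n + n) := block_mx A S S (- A).

Lemma halmos_herm : halmos ^t* = halmos.
Proof. by rewrite /halmos tr_block_mx map_block_mx hA hS adjN hA. Qed.

Lemma halmos_sqr : halmos *m halmos = 1%:M.
Proof.
rewrite /halmos mulmx_block AS cSA mulmxN mulNmx addrN.
by rewrite mulmxN mulNmx opprK cSA subrr addrC AS -scalar_mx_block.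
Qed.

Lemma halmos_compression (U := col_mx 1%:M 0 : 'M[C]_(n + n, n)) :
  U ^t* *m halmos *m U = A.
Proof.
rewrite /U /halmos tr_col_mx map_row_mx trmx1 trmx0 map_mx1 map_mx0.
rewrite mul_row_block mul_row_col !mulmx0 !mul1mx !mul0mx !mulmx1.
by rewrite !addr0.
Qed.

End Halmos.

(** * Projectors, and measurements obtained from reflections *)

Lemma sqn_proj_le n (P : 'M[C]_n) (v : 'cV[C]_n) :
  P ^t* = P -> P *m P = P -> sqn (P *m v) <= sqn v.
Proof.
move=> hP PP; rewrite -subr_ge0.
have -> : sqn v - sqn (P *m v) = sqn (v - P *m v); last exact: sqn_ge0.
have mxB (A B : 'M[C]_1) : (A - B) 0 0 = A 0 0 - B 0 0 by rewrite !mxE.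
have e : (P *m v) ^t* *m (P *m v) = v ^t* *m (P *m v).
  by rewrite adjM hP !mulmxA -(mulmxA _ P P) PP.
have e' : (P *m v) ^t* *m v = v ^t* *m (P *m v) by rewrite adjM hP mulmxA.
rewrite /sqn adjB mulmxBl !mulmxBr e e' subrr subr0 mxB.
by rewrite reD reN.
Qed.

(** Inverse to [observable]; for a reflection the two elements are its spectral projectors. *)
Definition outcomes n (A : 'M[C]_n) (x : bool) : 'M[C]_n :=
  toC 2^-1 *: (1%:M + (if x then - A else A)).

Lemma outcomes_measurement n (A : 'M[C]_n) :
  A ^t* = A -> A *m A = 1%:M -> measurement (outcomes A).
Proof.
move=> hA AA; split=> [x|]; last first.
  by rewrite big_bool /outcomes /= -scalerDr addrACA addNr addr0 half_double.
have h (B : 'M[C]_n) : B ^t* = B -> B *m B = 1%:M -> psd (toC 2^-1 *: (1%:M + B)).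
  move=> hB BB; set F := _ *: _.
  have hF : F ^t* = F by rewrite /F adjZ adjD adj1 hB.
  have -> : F = F ^t* *m F; last exact: psd_gram.
  rewrite hF /F -scalemxAl -scalemxAr mulmxDl !mulmxDr mul1mx !mulmx1 mul1mx BB.
  by rewrite (addrC B) half_double.
by case: x; apply: h; rewrite ?adjN ?mulNmx ?mulmxN ?opprK ?hA.
Qed.

Lemma tens_suml m n p q (I : finType) (F : I -> 'M[C]_(m, n)) (B : 'M[C]_(p, q)) :
  (\sum_i F i) *t B = \sum_i F i *t B.
Proof.
apply/matrixP => i j; rewrite summxE !mxE summxE mulr_suml.
by apply: eq_bigr => k _; rewrite !mxE.
Qed.

(** * The CHSH expectation, block by block *)

Section Blocks.
Variables (a d a' r : nat) (rho : 'M[C]_(a * d)) (U : 'M[C]_(a', a)).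
Variables (P : 'I_r -> 'M[C]_a').
Hypotheses (hrho : state rho) (hU : U ^t* *m U = 1%:M).
Hypothesis (hP : projective_measurement P).

(** The probability of outcome k of K' in the embedded state. *)
Definition weight k := expect (ptr2 rho) (U ^t* *m P k *m U).

Lemma weight_gram k :
  U ^t* *m P k *m U = (P k *m U) ^t* *m (P k *m U).
Proof. by rewrite adjM (hP.2 k).1 !mulmxA -(mulmxA _ (P k) (P k)) (hP.2 k).2. Qed.

Lemma weight_ge0 k : 0 <= weight k.
Proof.
rewrite /weight weight_gram; apply: expect_gram_ge0.
by case: (ptr2_state hrho).
Qed.

Lemma sum_weight : \sum_k weight k = 1.
Proof.
rewrite /weight -expect_sum -mulmx_suml -mulmx_sumr hP.1.2 mulmx1 hU.
exact/expect1/ptr2_state.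
Qed.

(** Cauchy-Schwarz is applied in each block to X P_k U and P_k U, whose second moments are
    [m k * weight k] and [weight k]. Nonnegativity is claimed for the product because [m k] is
    unconstrained where P_k = 0. *)
Lemma expect_tens_blocks_le (X : 'M[C]_a') (Rm : bool -> 'M[C]_d) (m : 'I_r -> R) :
  measurement Rm -> X ^t* = X -> (forall k, X *m P k = P k *m X) ->
  (forall k, X *m X *m P k = toC (m k) *: P k) ->
  (forall k, 0 <= m k * weight k) /\
  expect rho ((U ^t* *m X *m U) *t observable Rm) <=
    \sum_k Num.sqrt (m k * weight k) * Num.sqrt (weight k).
Proof.
move=> /measurement_observable[_ _ hR [S [hS _ RS]]] hX cX eX.
have [hrhoA _] := ptr2_state hrho.
have PXXP k : P k *m X *m (X *m P k) = X *m X *m P k.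
  by rewrite -cX -mulmxA (mulmxA (P k)) -cX -mulmxA (hP.2 k).2 mulmxA.
have XX k : expect (ptr2 rho) ((X *m P k *m U) ^t* *m (X *m P k *m U)) =
    m k * weight k.
  rewrite /weight -expectZ scalemxAl scalemxAr -eX -PXXP.
  by rewrite !adjM hX (hP.2 k).1 !mulmxA.
split=> [k|]; first by rewrite -XX; exact: expect_gram_ge0.
have -> : U ^t* *m X *m U = \sum_k (X *m P k *m U) ^t* *m (P k *m U).
  have e k : (X *m P k *m U) ^t* *m (P k *m U) = U ^t* *m X *m P k *m U.
    rewrite !adjM hX (hP.2 k).1 !mulmxA -(mulmxA _ (P k) X) -cX.
    by rewrite !mulmxA -(mulmxA _ (P k) (P k)) (hP.2 k).2.
  under eq_bigr => k _ do rewrite e.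
  by rewrite -mulmx_suml -mulmx_sumr hP.1.2 mulmx1.
rewrite tens_suml expect_sum; apply: ler_sum => k _.
rewrite -XX /weight weight_gram.
by have := expect_tens_observable_le (X *m P k *m U) (P k *m U) hrho.1 hR hS RS.
Qed.

End Blocks.

(** * The overlap of a block *)

Lemma l2Z n (s : R) (v : 'cV[C]_n) : l2 (toC s *: v) = `|s| * l2 v.
Proof. by rewrite /l2 sqnZ sqrtrM ?sqr_ge0 // sqrtr_sqr. Qed.

Lemma outcomes_comm n (A P : 'M[C]_n) x :
  A *m P = P *m A -> outcomes A x *m P = P *m outcomes A x.
Proof.
move=> cA; rewrite /outcomes -scalemxAl -scalemxAr mulmxDl mulmxDr mul1mx mulmx1.
by case: x; rewrite ?mulNmx ?mulmxN cA.
Qed.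

Lemma sum_outcomes_sandwich n (B M : 'M[C]_n) :
  \sum_y outcomes B y *m M *m outcomes B y = toC 2^-1 *: (M + B *m M *m B).
Proof.
have hh (X : 'M[C]_n) : (toC 2^-1 *: X) *m M *m (toC 2^-1 *: X) =
    toC 2^-1 *: (toC 2^-1 *: (X *m M *m X)).
  by rewrite -scalemxAr -!scalemxAl.
rewrite big_bool /outcomes /= !hh -!scalerDr; congr (_ *: _).
rewrite -[RHS]half_double; congr (_ *: _).
rewrite !mulmxDl !mulmxDr !mulmx1 !mul1mx !mulNmx !mulmxN.
move: (B *m M *m B) (B *m M) (M *m B) => X Y Z.
by apply/matrixP => i j; rewrite !mxE; ring.
Qed.

(** Since B^2 = 1, A + B A B = (A B + B A) B, and the anticommutator acts on the block as the scalar
    l. *)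
Lemma block_sandwich n (A B P : 'M[C]_n) (l : R) :
  B *m B = 1%:M -> B *m P = P *m B ->
  (A *m B + B *m A) *m P = toC l *: P ->
  (\sum_y outcomes B y *m (toC 2^-1 *: (1%:M + A)) *m outcomes B y) *m P =
    toC 2^-1 *: (P + toC (2^-1 * l) *: (P *m B)).
Proof.
move=> BB cB eC; rewrite sum_outcomes_sandwich -scalemxAl; congr (_ *: _).
have e : B *m (toC 2^-1 *: (1%:M + A)) *m B =
    toC 2^-1 *: (1%:M + B *m A *m B).
  by rewrite -scalemxAr -scalemxAl mulmxDr mulmxDl mulmx1 BB.
rewrite e -scalerDr addrACA.
have -> : A + B *m A *m B = (A *m B + B *m A) *m B.
  by rewrite mulmxDl -[A *m B *m B]mulmxA BB mulmx1.
rewrite -scalemxAl (mulmxDl (1%:M + 1%:M)) (mulmxDl 1%:M) mul1mx.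
rewrite -(mulmxA _ B P) cB mulmxA eC scalerDr.
by rewrite half_double -scalemxAl scalerA -rmorphM.
Qed.

(** All operators commute with P, so the pinching reduces to one factor P. By [block_sandwich] what
    remains is half of P + (l/2) P B up to the sign of l, and P and P B are contractions. *)
Lemma block_opn_le n (A B P : 'M[C]_n) (l : R) (x : bool) :
  B ^t* = B -> B *m B = 1%:M -> P ^t* = P -> P *m P = P ->
  A *m P = P *m A -> B *m P = P *m B ->
  (A *m B + B *m A) *m P = toC l *: P ->
  opn (\sum_y (P *m outcomes B y *m P) *m (P *m outcomes A x *m P) *m
              (P *m outcomes B y *m P)) <= 2^-1 * (1 + 2^-1 * `|l|).
Proof.
move=> hB BB hP PP cA cB eC.
have cP (Y Z : 'M[C]_n) : Y *m P = P *m Y -> Z *m P = P *m Z ->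
    (P *m Y *m P) *m (P *m Z *m P) *m (P *m Y *m P) = Y *m Z *m Y *m P.
  have pinch W : W *m P = P *m W -> P *m W *m P = W *m P.
    by move=> cW; rewrite -cW -mulmxA PP.
  have absorb V W : W *m P = P *m W -> (V *m P) *m (W *m P) = V *m W *m P.
    by move=> cW; rewrite -mulmxA (mulmxA P W P) pinch // mulmxA.
  by move=> cY cZ; rewrite !pinch // !absorb.
under eq_bigr => y _ do
  rewrite (cP _ _ (outcomes_comm y cB) (outcomes_comm x cA)).
rewrite -mulmx_suml.
(* Passing to the outcome [true] replaces A by -A, hence l by -l. *)
pose l' := if x then - l else l.
have -> : (\sum_y outcomes B y *m outcomes A x *m outcomes B y) *m P =
    toC 2^-1 *: (P + toC (2^-1 * l') *: (P *m B)).
  apply: block_sandwich => //; rewrite /l'; case: (x) => //.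
  by rewrite mulNmx mulmxN -opprD mulNmx eC rmorphN scaleNr.
have nl : `|l'| = `|l| by rewrite /l'; case: (x); rewrite ?normrN.
apply: opn_le => [|v v1].
  by rewrite mulr_ge0 ?invr_ge0 ?ler0n // addr_ge0 ?ler01 // mulr_ge0 ?invr_ge0 ?ler0n.
have P1 w : sqn w <= 1 -> l2 (P *m w) <= 1.
  move=> w1; rewrite -sqrtr1; apply: ler_wsqrtr.
  exact: le_trans (sqn_proj_le w hP PP) w1.
rewrite -scalemxAl l2Z ger0_norm ?invr_ge0 ?ler0n //.
apply: ler_wpM2l; first by rewrite invr_ge0 ler0n.
rewrite mulmxDl; apply: le_trans (l2_triangle _ _) _.
apply: lerD; first exact: P1.
rewrite -scalemxAl l2Z normrM nl ger0_norm ?invr_ge0 ?ler0n //.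
rewrite -[X in _ <= X]mulr1; apply: ler_wpM2l.
  by rewrite mulr_ge0 ?invr_ge0 ?ler0n.
rewrite -mulmxA; apply: P1.
by rewrite /sqn adjM hB mulmxA -(mulmxA _ B B) BB mulmx1.
Qed.

(** * Assembling the dilation *)

Lemma compression_blocks a a' r (U : 'M[C]_(a', a)) (P : 'I_r -> 'M[C]_a')
    (Y : 'M[C]_a') :
  projective_measurement P -> (forall k, Y *m P k = P k *m Y) ->
  \sum_k U ^t* *m P k *m Y *m P k *m U = U ^t* *m Y *m U.
Proof.
move=> hP cY.
have e k : U ^t* *m P k *m Y *m P k *m U = U ^t* *m Y *m P k *m U.
  by rewrite -(mulmxA _ (P k) Y) -cY !mulmxA -(mulmxA _ (P k) (P k)) (hP.2 k).2.
under eq_bigr => k _ do rewrite e.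
by rewrite -mulmx_suml -mulmx_sumr hP.1.2 mulmx1.
Qed.

Lemma compression_outcomes a a' (U : 'M[C]_(a', a)) (M : bool -> 'M[C]_a)
    (A : 'M[C]_a') x :
  measurement M -> U ^t* *m U = 1%:M -> U ^t* *m A *m U = observable M ->
  U ^t* *m outcomes A x *m U = M x.
Proof.
move=> /measurement_observable[eF eT _ _] hU hA.
rewrite /outcomes -scalemxAr -scalemxAl mulmxDr mulmxDl mulmx1 hU.
by case: x; rewrite ?mulmxN ?mulNmx hA.
Qed.

(** Both sides equal B + A B A. Hence the eigenspaces of the anticommutator reduce both
    reflections. *)
Lemma anticommutator_comm n (A B : 'M[C]_n) : A *m A = 1%:M ->
  A *m (A *m B + B *m A) = (A *m B + B *m A) *m A.
Proof.
move=> AA; rewrite mulmxDr mulmxDl !mulmxA AA mul1mx -(mulmxA B) AA mulmx1.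
exact: addrC.
Qed.

(** A single parameter controls both quantities. With x = (1 + w)/2 in [1/2, 1], the overlap is at
    most x and the CHSH value at most 2 (sqrt x + sqrt (1 - x)). *)
Lemma dilation_exists a d (rho : 'M[C]_(a * d)) (M N : bool -> 'M[C]_a)
    (Rm Sm : bool -> 'M[C]_d) :
  state rho -> measurement M -> measurement N ->
  measurement Rm -> measurement Sm ->
  exists (a' r : nat) (U : 'M[C]_(a', a)) (M' N' : bool -> 'M[C]_a')
      (P : 'I_r -> 'M[C]_a') (w : R),
    [/\ feasible M N U M' N' P,
        overlap_value (ptr2 rho) U M' N' P <= 2^-1 * (1 + w), 0 <= w, w <= 1 &
        chsh_value rho M N Rm Sm <= Num.sqrt (2 + 2 * w) + Num.sqrt (2 - 2 * w)].
Proof.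
move=> hrho hM hN hR hS.
have [_ _ hA [SA [hSA cSA ASA]]] := measurement_observable hM.
have [_ _ hB [SB [hSB cSB BSB]]] := measurement_observable hN.
set A := observable M in hA cSA ASA; set B := observable N in hB cSB BSB.
pose A' := halmos A SA; pose B' := halmos B SB.
have hA' : A' ^t* = A' by exact: halmos_herm.
have hB' : B' ^t* = B' by exact: halmos_herm.
have AA : A' *m A' = 1%:M by exact: halmos_sqr.
have BB : B' *m B' = 1%:M by exact: halmos_sqr.
pose U := col_mx 1%:M 0 : 'M[C]_(a + a, a).
have hU : U ^t* *m U = 1%:M.
  rewrite /U tr_col_mx map_row_mx trmx1 trmx0 map_mx1 map_mx0.
  by rewrite mul_row_col mulmx0 addr0 mul1mx.
have UA : U ^t* *m A' *m U = A by exact: halmos_compression.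
have UB : U ^t* *m B' *m U = B by exact: halmos_compression.
move: A' B' U hA' hB' AA BB hU UA UB => A' B' U hA' hB' AA BB hU UA UB.
pose K := A' *m B' + B' *m A'.
have hK : K ^t* = K by rewrite /K adjD !adjM hA' hB' addrC.
have [r [P [l [hP eK cK]]]] := spectral_resolution hK.
have cA k : A' *m P k = P k *m A' by apply: cK; exact: anticommutator_comm.
have cB k : B' *m P k = P k *m B'.
  by apply: cK; rewrite /K addrC; exact: anticommutator_comm.
pose p := weight rho U P.
have p0 k : 0 <= p k by exact: weight_ge0.
have p1 : \sum_k p k = 1 by exact: sum_weight.
have [plus_ge0 plus_le] :
    (forall k, 0 <= (2 + l k) * p k) /\
    expect rho ((U ^t* *m (A' + B') *m U) *t observable Rm) <=
      \sum_k Num.sqrt ((2 + l k) * p k) * Num.sqrt (p k).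
  apply: expect_tens_blocks_le => // [|k|k].
  - by rewrite adjD hA' hB'.
  - by rewrite mulmxDl mulmxDr cA cB.
  - have -> : (A' + B') *m (A' + B') = 1%:M + 1%:M + K.
      rewrite mulmxDl !mulmxDr AA BB /K; move: (A' *m B') (B' *m A') => X Y.
      by apply/matrixP => i j; rewrite !mxE; ring.
    rewrite (mulmxDl (1%:M + 1%:M)) (mulmxDl 1%:M) !mul1mx eK rmorphD rmorph_nat.
    by rewrite scalerDl scaler_nat mulr2n.
have [minus_ge0 minus_le] :
    (forall k, 0 <= (2 - l k) * p k) /\
    expect rho ((U ^t* *m (A' - B') *m U) *t observable Sm) <=
      \sum_k Num.sqrt ((2 - l k) * p k) * Num.sqrt (p k).
  apply: expect_tens_blocks_le => // [|k|k].
  - by rewrite adjB hA' hB'.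
  - by rewrite mulmxBl mulmxBr cA cB.
  - have -> : (A' - B') *m (A' - B') = 1%:M + 1%:M - K.
      rewrite mulmxBl !mulmxBr AA BB /K; move: (A' *m B') (B' *m A') => X Y.
      by apply/matrixP => i j; rewrite !mxE; ring.
    rewrite mulmxBl (mulmxDl 1%:M) !mul1mx eK rmorphB rmorph_nat scalerBl scaler_nat.
    by rewrite mulr2n.
(* In each block the pair 2 + l, 2 - l is sorted by size. This leaves the sum of the two roots
   unchanged and makes the averages depend on |l|, as the overlap does. *)
pose hi k := (2 + `|l k|) * p k; pose lo k := (2 - `|l k|) * p k.
have hi0 k : 0 <= hi k.
  by rewrite mulr_ge0 ?addr_ge0 ?ler0n ?normr_ge0.
have lo0 k : 0 <= lo k.
  rewrite /lo; case: (ger0P (l k)) => _; first exact: minus_ge0.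
  by rewrite opprK plus_ge0.
pose w := 2^-1 * \sum_k `|l k| * p k.
have w0 : 0 <= w.
  by rewrite mulr_ge0 ?invr_ge0 ?ler0n // sumr_ge0 // => k _; rewrite mulr_ge0.
have w2 : \sum_k `|l k| * p k = 2 * w.
  by rewrite /w mulrA mulfV ?pnatr_eq0 // mul1r.
have shi : \sum_k hi k = 2 + 2 * w.
  under eq_bigr => k _ do rewrite /hi mulrDl.
  by rewrite big_split /= -mulr_sumr p1 mulr1 w2.
have slo : \sum_k lo k = 2 - 2 * w.
  under eq_bigr => k _ do rewrite /lo mulrBl.
  by rewrite sumrB -mulr_sumr p1 mulr1 w2.
have w1 : w <= 1.
  have : 0 <= \sum_k lo k by apply: sumr_ge0.
  by rewrite slo; lra.
exists (a + a)%N, r, U, (outcomes A'), (outcomes B'), P, w; split=> //.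
- split=> //; try exact: outcomes_measurement.
  split=> [x|y]; rewrite compression_blocks //; try exact: compression_outcomes.
    by move=> k; exact: outcomes_comm.
  by move=> k; exact: outcomes_comm.
- have -> : 2^-1 * (1 + w) = \sum_k p k * (2^-1 * (1 + 2^-1 * `|l k|)).
    have e k : p k * (2^-1 * (1 + 2^-1 * `|l k|)) =
        2^-1 * p k + 2^-1 * 2^-1 * (`|l k| * p k) by ring.
    under [RHS]eq_bigr => k _ do rewrite e.
    by rewrite big_split /= -!mulr_sumr p1 w2; field.
  apply: ler_sum => k _; rewrite -expect_conj -/(p k).
  apply: (ler_wpM2l (p0 k)); apply: bigmax_le.
    by rewrite mulr_ge0 ?invr_ge0 ?ler0n // addr_ge0 ?ler01 // mulr_ge0 ?invr_ge0 ?ler0n.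
  move=> x _.
  exact: (block_opn_le x hB' BB (hP.2 k).1 (hP.2 k).2 (cA k) (cB k) (eK k)).
rewrite chshE // -/A -/B -UA -UB.
rewrite -mulmxDl -mulmxDr -mulmxBl -mulmxBr.
apply: le_trans (lerD plus_le minus_le) _; rewrite -big_split /=.
have -> : \sum_k (Num.sqrt ((2 + l k) * p k) * Num.sqrt (p k) +
                 Num.sqrt ((2 - l k) * p k) * Num.sqrt (p k)) =
    \sum_k Num.sqrt (hi k) * Num.sqrt (p k) +
    \sum_k Num.sqrt (lo k) * Num.sqrt (p k).
  rewrite -big_split /=; apply: eq_bigr => k _; rewrite /hi /lo.
  by case: (ger0P (l k)) => _ //; rewrite opprK addrC.
(* Cauchy-Schwarz over the blocks, against weights of total 1. *)
have := lerD (sum_sqrtM_le hi0 p0) (sum_sqrtM_le lo0 p0).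
by rewrite p1 sqrtr1 !mulr1 shi slo.
Qed.

(** * The two cases of part (i), and the inversion for part (ii) *)

Lemma expect_observable_sqr n (rho : 'M[C]_n) (M : bool -> 'M[C]_n) :
  state rho -> measurement M ->
  0 <= expect rho (observable M *m observable M) <= 1.
Proof.
move=> hrho /measurement_observable[_ _ hA [S [hS _ AS]]].
apply/andP; split.
  by rewrite -{1}hA; apply: expect_gram_ge0; case: hrho.
rewrite -(expect1 hrho) -AS expectD lerDl -{1}hS.
by apply: expect_gram_ge0; case: hrho.
Qed.

Lemma expect_sum_sqr n (rho : 'M[C]_n) (N : bool -> 'M[C]_n) :
  state rho -> measurement N ->
  2^-1 * \sum_y expect rho (N y *m N y) =
    (1 + expect rho (observable N *m observable N)) / 4.
Proof.
move=> hrho /measurement_observable[eF eT _ _].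
rewrite big_bool /= eF eT -expectD; move: (observable N) => B.
have -> : (toC 2^-1 *: (1%:M - B)) *m (toC 2^-1 *: (1%:M - B)) +
    (toC 2^-1 *: (1%:M + B)) *m (toC 2^-1 *: (1%:M + B)) =
    toC 2^-1 *: (1%:M + B *m B).
  rewrite -!scalemxAl -!scalemxAr -!scalerDr -[in RHS](half_double (1%:M + _)).
  congr (_ *: (_ *: _)); rewrite !mulmxDl !mulmxDr !mul1mx !mulmx1.
  rewrite !(mulNmx, mulmxN) opprK; move: (B *m B) => X.
  by apply/matrixP => i j; rewrite !mxE; ring.
by rewrite expectZ expectD expect1 //; field.
Qed.

(** The square of sqrt z + sqrt (1 - z) is 1 + 2 sqrt (z (1 - z)). Comparing z (1 - z) covers both
    halves of [0, 1] at once. *)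
Lemma sqrt_addC_mono (x y : R) :
  0 <= x -> x <= 1 -> 0 <= y -> y <= 1 -> x * (1 - x) <= y * (1 - y) ->
  Num.sqrt x + Num.sqrt (1 - x) <= Num.sqrt y + Num.sqrt (1 - y).
Proof.
move=> x0 x1 y0 y1 xy.
have e (z : R) : 0 <= z -> z <= 1 ->
    Num.sqrt z + Num.sqrt (1 - z) = Num.sqrt (1 + 2 * Num.sqrt (z * (1 - z))).
  move=> z0 z1; rewrite -[LHS]ger0_norm ?addr_ge0 ?sqrtr_ge0 // -sqrtr_sqr.
  congr Num.sqrt; rewrite sqrrD !sqr_sqrtr ?subr_ge0 // sqrtrM // mulr_natl.
  by ring.
rewrite !e //; apply: ler_wsqrtr; rewrite lerD2l ler_wpM2l ?ler0n //.
exact: ler_wsqrtr.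
Qed.

Lemma sqrt4M (x : R) : Num.sqrt (4 * x) = 2 * Num.sqrt x.
Proof.
have -> : 4 = 2 ^+ 2 :> R by ring.
by rewrite sqrtrM ?sqr_ge0 // sqrtr_sqr ger0_norm ?ler0n.
Qed.

(** Cauchy-Schwarz against the identity gives sqrt x + sqrt y for the second moments x, y of A + B
    and A - B. By the parallelogram law x + y <= 2 + 2 b, and sqrt x + sqrt y <= sqrt (2 (x +
    y)). *)
Lemma chsh_value_le_trivial a d (rho : 'M[C]_(a * d)) (M N : bool -> 'M[C]_a)
    (Rm Sm : bool -> 'M[C]_d)
    (b := expect (ptr2 rho) (observable N *m observable N)) :
  state rho -> measurement M -> measurement N ->
  measurement Rm -> measurement Sm ->
  chsh_value rho M N Rm Sm <= 2 * Num.sqrt (1 + b).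
Proof.
move=> hrho hM hN hR hS; have hrhoA := ptr2_state hrho.
have /andP[_ a1] := expect_observable_sqr hrhoA hM.
rewrite chshE //; have [_ _ hA _] := measurement_observable hM.
have [_ _ hB _] := measurement_observable hN; rewrite /b {b}.
move: (observable M) (observable N) hA hB a1 => A B hA hB a1.
have key (X : 'M[C]_a) (Q : bool -> 'M[C]_d) : X ^t* = X -> measurement Q ->
    expect rho (X *t observable Q) <= Num.sqrt (expect (ptr2 rho) (X *m X)).
  move=> hX /measurement_observable[_ _ hQ [S [hQS _ QS]]].
  have := expect_tens_observable_le X 1%:M hrho.1 hQ hQS QS.
  by rewrite hX adj1 !mulmx1 expect1 // sqrtr1 mulr1.
have hX : (A + B) ^t* = A + B by rewrite adjD hA hB.
have hY : (A - B) ^t* = A - B by rewrite adjB hA hB.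
apply: le_trans (lerD (key _ _ hX hR) (key _ _ hY hS)) _.
have x0 : 0 <= expect (ptr2 rho) ((A + B) *m (A + B)).
  by rewrite -{1}hX; apply: expect_gram_ge0; case: hrhoA.
have y0 : 0 <= expect (ptr2 rho) ((A - B) *m (A - B)).
  by rewrite -{1}hY; apply: expect_gram_ge0; case: hrhoA.
have : expect (ptr2 rho) ((A + B) *m (A + B)) +
    expect (ptr2 rho) ((A - B) *m (A - B)) =
    2 * expect (ptr2 rho) (A *m A) + 2 * expect (ptr2 rho) (B *m B).
  rewrite !mulmxDl !mulmxDr !(mulNmx, mulmxN) opprK !(expectD, expectN).
  by ring.
move: (expect _ _) (expect _ _) x0 y0 => x y x0 y0 xy.
rewrite -sqrt4M -[X in X <= _]ger0_norm ?addr_ge0 ?sqrtr_ge0 // -sqrtr_sqr.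
apply: ler_wsqrtr; move: (sqr_ge0 (Num.sqrt x - Num.sqrt y)).
move: (sqr_sqrtr x0) (sqr_sqrtr y0) xy a1; move: (Num.sqrt x) (Num.sqrt y).
by move=> s t; nra.
Qed.

Lemma chsh_value_le a d (rho : 'M[C]_(a * d)) (M N : bool -> 'M[C]_a)
    (Rm Sm : bool -> 'M[C]_d) (c : R) :
  state rho -> measurement M -> measurement N ->
  measurement Rm -> measurement Sm ->
  2^-1 * \sum_y expect (ptr2 rho) (N y *m N y) <= c ->
  (forall a' r (U : 'M[C]_(a', a)) M' N' (P : 'I_r -> 'M[C]_a'),
     feasible M N U M' N' P -> c <= overlap_value (ptr2 rho) U M' N' P) ->
  [/\ 0 <= c, c <= 1 &
      chsh_value rho M N Rm Sm <= 2 * (Num.sqrt c + Num.sqrt (1 - c))].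
Proof.
move=> hrho hM hN hR hS lbc ubc; have hrhoA := ptr2_state hrho.
have := chsh_value_le_trivial hrho hM hN hR hS.
have /andP[] := expect_observable_sqr hrhoA hN.
rewrite expect_sum_sqr // in lbc; move: (expect _ _) lbc => b lbc b0 b1 hb.
have [a' [r [U [M' [N' [P [w [feas vw w0 w1 hw]]]]]]]] :=
  dilation_exists hrho hM hN hR hS.
have cw := le_trans (ubc _ _ _ _ _ _ feas) vw.
have c0 : 0 <= c by lra.
have c1 : c <= 1 by lra.
split=> //; have [ch|ch] := leP c 2^-1.
  (* Here x = (1 + b)/4 <= c <= 1/2, so x (1 - x) <= c (1 - c). *)
  apply: le_trans hb _; rewrite ler_pM2l ?ltr0n //.
  pose x := (1 + b) / 4.
  apply: (@le_trans _ _ (Num.sqrt x + Num.sqrt (1 - x))); last first.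
    by apply: sqrt_addC_mono; rewrite /x; nra.
  rewrite -[X in _ <= X]ger0_norm ?addr_ge0 ?sqrtr_ge0 // -sqrtr_sqr.
  apply: ler_wsqrtr; rewrite sqrrD !sqr_sqrtr; try by rewrite /x; lra.
  (* Squared, this is b^2 <= 4 x (1 - x), which amounts to (1 - b) (5 b + 3) >= 0. *)
  have : b <= Num.sqrt x * Num.sqrt (1 - x) *+ 2; last by rewrite /x; lra.
  rewrite -mulr_natl -sqrtrM; last by rewrite /x; lra.
  rewrite -sqrt4M -[X in X <= _]ger0_norm // -sqrtr_sqr; apply: ler_wsqrtr.
  by rewrite /x; nra.
(* Here 1/2 < c <= x = (1 + w)/2, so again x (1 - x) <= c (1 - c). *)
apply: le_trans hw _; pose x := 2^-1 * (1 + w).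
have -> : 2 + 2 * w = 4 * x by rewrite /x; field.
have -> : 2 - 2 * w = 4 * (1 - x) by rewrite /x; field.
rewrite !sqrt4M -mulrDr ler_pM2l ?ltr0n //.
by apply: sqrt_addC_mono; rewrite /x; nra.
Qed.

(** Squaring twice gives (beta^2 - 4)^2 <= 64 c (1 - c) = 16 - 64 (c - 1/2)^2, that is 64 (c -
    1/2)^2 <= beta^2 (8 - beta^2). *)
Lemma overlap_le_of_chsh (beta c : R) :
  2 <= beta -> 0 <= c -> c <= 1 ->
  beta <= 2 * (Num.sqrt c + Num.sqrt (1 - c)) ->
  c <= 1 / 2 + beta / 8 * Num.sqrt (8 - beta ^+ 2).
Proof.
move=> b2 c0 c1 hb; rewrite -lerBlDl.
have b0 : 0 <= beta / 8 by lra.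
rewrite -(ger0_norm b0) -sqrtr_sqr -sqrtrM ?sqr_ge0 //.
apply: le_trans (ler_norm _) _; rewrite -sqrtr_sqr; apply: ler_wsqrtr.
have d0 : 0 <= 1 - c by lra.
move: (sqr_sqrtr c0) (sqr_sqrtr d0) (sqrtr_ge0 c) (sqrtr_ge0 (1 - c)) hb.
move: (Num.sqrt c) (Num.sqrt (1 - c)) => s t es et s0 t0 hb.
have st : beta ^+ 2 <= 4 + 8 * (s * t).
  have -> : 4 + 8 * (s * t) = (2 * (s + t)) ^+ 2.
    by transitivity (4 * (s ^+ 2 + t ^+ 2) + 8 * (s * t)); [rewrite es et|]; ring.
  by rewrite lerXn2r ?nnegrE //; lra.
(* The second squaring rests on beta^2 >= 4. *)
have st2 : (beta ^+ 2 - 4) ^+ 2 <= (8 * (s * t)) ^+ 2.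
  rewrite lerXn2r ?nnegrE //; last by lra.
    by nra.
  by rewrite mulr_ge0 ?ler0n // mulr_ge0.
have e : (8 * (s * t)) ^+ 2 = 64 * (c * (1 - c)) by rewrite -et -es; ring.
by rewrite e in st2; nra.
Qed.

End RealPart.

(** * Specialization to [R[i]] *)

Section Concrete.
Variable R : realType.
Local Notation toC := (real_complex R).
Local Notation re := (@complex.Re R).

Lemma Re_add : {morph re : x y / x + y}.
Proof. by move=> [? ?] []. Qed.

Lemma Re_real_mul (r : R) (x : R[i]) : re (toC r * x) = r * re x.
Proof. by case: x => u v /=; rewrite mul0r subr0. Qed.

Lemma Re_conjC (x : R[i]) : re (Num.conj x) = re x.
Proof. by case: x. Qed.

Lemma Re_nneg (x : R[i]) : 0 <= x -> 0 <= re x.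
Proof. by rewrite lecE => /andP[]. Qed.

Lemma real_complex_nneg (r : R) : 0 <= r -> 0 <= toC r.
Proof. by rewrite ler0c. Qed.

Lemma chsh_eff_overlap a d (rho : 'M[R[i]]_(a * d)) (M N : bool -> 'M[R[i]]_a)
    (Rm Sm : bool -> 'M[R[i]]_d) (c := eff_overlap (ptrace2 rho) M N) :
  is_state rho -> is_measurement M -> is_measurement N ->
  is_measurement Rm -> is_measurement Sm ->
  [/\ 0 <= c, c <= 1 &
      chsh rho M N Rm Sm <= 2 * (Num.sqrt c + Num.sqrt (1 - c))].
Proof.
move=> hrho hM hN hR hS.
have h := chsh_value_le Re_add Re_real_mul Re_conjC Re_nneg real_complex_nneg
  (@RRe_real R) hrho hM hN hR hS.
have [hrhoA _] := ptr2_state hrho.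
have hl a' r (U : 'M[R[i]]_(a', a)) M' N' (P : 'I_r -> 'M[R[i]]_a') :=
  overlap_value_ge Re_add Re_real_mul Re_conjC Re_nneg real_complex_nneg
    (@RRe_real R) (M := M) (U := U) (M' := M') (N' := N') (P := P) hrhoA hN.
(* The dilation shows that the set of feasible values is nonempty, so that [inf] is not a default
   value. *)
have [a' [r [U [M' [N' [P [w [feas _ _ _ _]]]]]]]] :=
  dilation_exists Re_add Re_real_mul Re_conjC Re_nneg real_complex_nneg
    (@RRe_real R) hrho hM hN hR hS.
apply: h => [|a2 r2 U2 M2 N2 P2 feas2].
  apply: lb_le_inf.
    by exists (eff_overlap_value (ptrace2 rho) U M' N' P), a', r, U, M', N', P.
  by move=> _ [a2 [r2 [U2 [M2 [N2 [P2 [feas2 ->]]]]]]]; apply: hl.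
(* For [inf] to be a lower bound the set must be bounded below, which [hl] provides. *)
apply: ge_inf; last by exists a2, r2, U2, M2, N2, P2.
eexists => _ [a3 [r3 [U3 [M3 [N3 [P3 [feas3 ->]]]]]]]; exact: hl feas3.
Qed.

End Concrete.

(* [2 <= beta] in (ii): the right-hand side is the inverse of c |-> 2 (sqrt c +
   sqrt (1 - c)) on [1/2, 1] only for beta in [2, 2 sqrt 2]. For each beta in
   [-2, 2) it is < 1, while M = N = (1, 0) has effective overlap 1 and attains
   that beta. *)
Theorem theorem3 (R : realType) :
  (forall (a : nat) (rhoA : 'M[R[i]]_a) (M N : bool -> 'M[R[i]]_a),
     is_state rhoA -> is_measurement M -> is_measurement N ->
     let c := eff_overlap rhoA M N in
     forall (d : nat) (rho : 'M[R[i]]_(a * d)) (Rm Sm : bool -> 'M[R[i]]_d),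
     is_state rho -> ptrace2 rho = rhoA ->
     is_measurement Rm -> is_measurement Sm ->
     chsh rho M N Rm Sm <= 2 * (Num.sqrt c + Num.sqrt (1 - c)))
  /\
  (forall (a d : nat) (rho : 'M[R[i]]_(a * d))
     (M N : bool -> 'M[R[i]]_a) (Rm Sm : bool -> 'M[R[i]]_d),
     is_state rho -> is_measurement M -> is_measurement N ->
     is_measurement Rm -> is_measurement Sm ->
     let beta := chsh rho M N Rm Sm in
     2 <= beta ->
     eff_overlap (ptrace2 rho) M N
       <= 1 / 2 + beta / 8 * Num.sqrt (8 - beta ^+ 2)).
Proof.
split=> [a rhoA M N hrhoA hM hN c d rho Rm Sm hrho e hR hS|].
  by rewrite /c -e; have [] := chsh_eff_overlap hrho hM hN hR hS.
move=> a d rho M N Rm Sm hrho hM hN hR hS beta b2.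
have [c0 c1 hb] := chsh_eff_overlap hrho hM hN hR hS.
exact: overlap_le_of_chsh.
Qed.
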